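(* Let ${\bf V}$ be the $N\times N$ random Vandermonde matrix whose phases $\theta_1,\dots,\theta_N$ are i.i.d. with law $\nu$, where $\nu$ is absolutely continuous on $[-\pi,\pi]$ with bounded density $f\in L^\infty([-\pi,\pi])$, and let $\lambda_N$ be the largest eigenvalue of ${\bf V}^*{\bf V}$. Set $C=4\pi\|f\|_\infty(e-1)+1$. There is a constant $K>0$, independent of $\epsilon,\kappa,u,N$, such that for every $\epsilon>0$ and $\kappa\in(0,1)$ there exists $N(\kappa,\epsilon)$ with $$\mathbb{P}\big(\lambda_N\ge (C+\epsilon)\log N+u\big)\le K\frac{e^{-u}}{N^{\epsilon\kappa}}$$ for all $u\ge0$ and all $N>N(\kappa,\epsilon)$.
   Context: ${\bf V}=N^{-1/2}(e^{-j(k-1)\theta_l})_{1\le k,l\le N}$. *)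

(* Defs.v *)
From HB Require Import structures.
From mathcomp Require Import all_boot all_order all_algebra.
From mathcomp Require Import all_classical all_reals all_analysis.
From mathcomp Require Import complex ess_sup_inf.
Set Implicit Arguments. Unset Strict Implicit. Unset Printing Implicit Defensive.
Import Order.TTheory GRing.Theory Num.Theory.
Local Open Scope classical_set_scope.
Local Open Scope ring_scope.

Section Defs.
Variable R : realType.

Definition expj (x : R) : R[i] := (cos x +i* sin x)%C.

(* V = N^{-1/2} (e^{-j (k-1) theta_l})_{1<=k,l<=N}; with 0-based row index k *)
Definition vandermonde (N : nat) (theta : 'I_N -> R) : 'M[R[i]]_N :=
  \matrix_(k < N, l < N) ((((Num.sqrt (N%:R : R))^-1)%:C)%C * expj (- ((k%:R : R) * theta l))).

Definition adjmx (m n : nat) (A : 'M[R[i]]_(m, n)) : 'M[R[i]]_(n, m) :=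
  (map_mx conjc A)^T.

(* largest eigenvalue of a (Hermitian) complex matrix: the supremum of
   the (real parts of the) eigenvalues; for Hermitian matrices all
   eigenvalues are real, so this is the largest eigenvalue. *)
Definition lambda_max (n : nat) (A : 'M[R[i]]_n) : R :=
  sup [set x : R | exists a : R[i], eigenvalue A a /\ x = complex.Re a].

Definition law_of_density (f : R -> R) (A : set R) : \bar R :=
  (\int[lebesgue_measure]_(x in A `&` `[(-pi)%R, pi%R]%classic) (f x)%:E)%E.

Definition Linf_norm_pi (f : R -> R) : \bar R :=
  ess_sup lebesgue_measure (fun x : R => (`|f x| * \1_(`[-pi, pi]) x)%:E).

(* theta_1, ..., theta_N are i.i.d. random variables with law nu on the
   probability space (Omega, P): each is measurable and the joint law is the
   product law (product rule on all measurable rectangles). *)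
Definition iid_with_law (d : measure_display) (Omega : measurableType d)
  (P : probability Omega R) (N : nat) (theta : 'I_N -> Omega -> R)
  (nu : set R -> \bar R) : Prop :=
  (forall i, measurable_fun setT (theta i)) /\
  (forall A : 'I_N -> set R, (forall i, measurable (A i)) ->
     P [set w | forall i, A i (theta i w)] = (\prod_(i < N) nu (A i))%E).

End Defs.

(* Main.v *)
(* Gershgorin's theorem bounds the largest eigenvalue of V^*V by the largest
   column sum of |D_N(theta_l - theta_m)| / N, with D_N the Dirichlet kernel.
   Cut [-pi, pi[ into N equal cells. If theta_l and theta_m lie in cells i and j,
   the entry is at most a kernel h(i, j) <= 1 decaying like the inverse of the
   circular distance of the cells, whose row sums are at most 2 ln N + 6.
   The cells visited by the phases are i.i.d. with atoms at most 2 pi M / N, so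
   the event reduces to a finite sum over configurations of cells. Conditionally
   on the cell of theta_m, Markov's inequality for exp together with
   e^x <= 1 + (e - 1) x on [0, 1] bounds the probability that one column sum exceeds t
   by a constant times e^{-t} N^{4 pi M (e - 1)}, and a union bound costs a factor N.

   A measure takes arbitrary values on non-measurable sets, so the event must be
   shown measurable: A = V^*V is positive semidefinite, hence t <= lambda_max A
   iff t^k <= tr(A^k) for all k. *)
Require Import Defs.
From HB Require Import structures.
From mathcomp Require Import all_boot all_order all_algebra.
From mathcomp Require Import all_classical all_reals all_analysis.
From mathcomp Require Import complex ess_sup_inf.
From mathcomp Require Import measurable_realfun spectral ring lra zify.
Set Implicit Arguments. Unset Strict Implicit. Unset Printing Implicit Defensive.
Import Order.TTheory GRing.Theory Num.Theory.
Local Open Scope classical_set_scope.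
Local Open Scope ring_scope.
Import numFieldNormedType.Exports.

Local Notation normc := ComplexField.Normc.normc.

(** * Dirichlet kernel, sine lower bounds and the entries of the Gram matrix *)

Section Dirichlet.
Variable R : realType.
Implicit Types (x y t : R) (n : nat).

Lemma normc_sum (I : Type) (r : seq I) (F : I -> R[i]) :
  normc (\sum_(i <- r) F i) <= \sum_(i <- r) normc (F i).
Proof.
elim/big_ind2 : _ => [|x1 y1 x2 y2 h1 h2|//]; first by rewrite ComplexField.Normc.normc0.
exact: le_trans (le_normcD _ _) (lerD h1 h2).
Qed.

Lemma normcR (c : R) : 0 <= c -> normc c%:C%C = c.
Proof. by move=> c0; rewrite /= expr0n /= addr0 sqrtr_sqr ger0_norm. Qed.

Lemma expj0 : expj 0 = 1 :> R[i].
Proof. by rewrite /expj cos0 sin0. Qed.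

Lemma expjD x y : expj (x + y) = expj x * expj y.
Proof.
by apply/eqP; rewrite eq_complex /= cosD sinD addrC eqxx [X in _ == X]addrC mulrC eqxx.
Qed.

Lemma expj_natM n x : expj (n%:R * x) = expj x ^+ n.
Proof.
elim: n => [|n IH]; first by rewrite mul0r expj0.
by rewrite -natr1 mulrDl mul1r expjD IH exprSr.
Qed.

Lemma conjc_expj x : conjc (expj x) = expj (- x).
Proof. by rewrite /expj cosN sinN. Qed.

Lemma normc_expj x : normc (expj x) = 1.
Proof. by rewrite /= cos2Dsin2 sqrtr1. Qed.

(** The double-angle formulas at t / 2 turn the squared modulus into (2 sin (t / 2))^2. *)
Lemma normc_expj_sub1 t : normc (expj t - 1) = 2 * `|sin (t / 2)|.
Proof.
have e : t = (t / 2) *+ 2 by rewrite -[RHS]mulr_natr divfK.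
rewrite {1}e /= cos_mulr2n sin_mulr2n.
set s := sin _; set c := cos _.
have cs : c ^+ 2 = 1 - s ^+ 2 by rewrite -cos2sin2.
have -> : (c ^+ 2 *+ 2 - 1 - 1) ^+ 2 + ((c * s) *+ 2 + - 0) ^+ 2 = (2 * s) ^+ 2.
  by ring: cs.
by rewrite sqrtr_sqr normrM ger0_norm.
Qed.

(** Geometric sum: multiplied by e^{jt} - 1 it telescopes to e^{jnt} - 1, of modulus at most 2. The
    product form avoids dividing by a sine that may vanish. *)
Lemma dirichlet_le_sin n t :
  normc (\sum_(k < n) expj (k%:R * t)) * `|sin (t / 2)| <= 1.
Proof.
have : normc ((expj t - 1) * \sum_(k < n) expj (k%:R * t)) <= 2.
  under eq_bigr do rewrite expj_natM.
  rewrite -subrX1 -expj_natM; apply: le_trans (le_normcD _ _) _.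
  by rewrite normcN normc_expj ComplexField.Normc.normc1.
rewrite ComplexField.Normc.normcM normc_expj_sub1 -mulrA mulrC -subr_ge0 => h.
lra.
Qed.

Lemma dirichlet_le_nat n t : normc (\sum_(k < n) expj (k%:R * t)) <= n%:R.
Proof.
apply: le_trans (normc_sum _ _) _.
by under eq_bigr do rewrite normc_expj; rewrite sumr_const card_ord.
Qed.

(** By the mean value theorem sin x = x cos c with 0 <= c <= x, and the cosine decreases on
    [0, pi]. *)
Lemma sin_ge_mul_cos x : 0 <= x <= pi -> x * cos x <= sin x.
Proof.
move=> /andP[x0 xpi].
have [c cx] : exists2 c, c \in `[0, x] & sin x - sin 0 = cos c * (x - 0).
  apply: MVT_segment => //.
  exact/continuous_subspaceT/continuous_sin.
rewrite sin0 !subr0 => ->; rewrite mulrC ler_wpM2r//.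
move: cx; rewrite in_itv/= => /andP[c0 cx].
rewrite leNgt ltr_cos ?in_itv/= ?x0 ?c0 ?xpi ?(le_trans cx)// -leNgt; exact: cx.
Qed.

(** With y = x / 2, the previous bound at y gives sin x = 2 sin y cos y >= 2 y cos^2 y = y (1 + cos
    x) >= y. *)
Lemma sin_ge_half x : 0 <= x <= pi / 2 -> x / 2 <= sin x.
Proof.
move=> /andP[x0 xpi]; have pi0 := pi_gt0 R.
have e : x = (x / 2) *+ 2 by rewrite -[RHS]mulr_natr divfK.
rewrite [X in sin X]e sin_mulr2n.
have c0 : 0 <= cos x by apply: cos_ge0_pihalf; lra.
have := c0; rewrite e cos_mulr2n -e => c1.
have h : 0 <= cos (x / 2) by apply: cos_ge0_pihalf; lra.
have := sin_ge_mul_cos (x := x / 2); move/(_ ltac:(lra)) => /(ler_wpM2l h).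
set c := cos _ in h c1 *; set s := sin _ => hs.
have : 0 <= x * (c ^+ 2 *+ 2 - 1) by rewrite mulr_ge0.
have : c * (x / 2 * c) = x / 2 * c ^+ 2 by ring.
nra.
Qed.

Lemma sin_ge_half_sub x : pi / 2 <= x <= pi -> (pi - x) / 2 <= sin x.
Proof.
move=> xpi; have -> : sin x = sin (pi - x).
  by rewrite sinB sinpi cospi mul0r sub0r mulN1r opprK.
by apply: sin_ge_half; lra.
Qed.

Lemma gram_vandermondeE n (theta : 'I_n -> R) (l m : 'I_n) :
  (adjmx (vandermonde theta) *m vandermonde theta) l m =
  (n%:R^-1)%:C%C * \sum_(k < n) expj (k%:R * (theta l - theta m)).
Proof.
rewrite mxE mulr_sumr; apply: eq_bigr => k _.
rewrite !mxE [conjc _]rmorphM [X in X * _ * _]conjc_real [X in _ * X * _]conjc_expj opprK mulrACA -expjD -mulrBr.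
congr (_ * _); rewrite -rmorphM; congr (_%:C)%C.
by rewrite -invfM -expr2 sqr_sqrtr.
Qed.

End Dirichlet.

(** * Exponential moments and a Chernoff bound over finite configurations *)

Section Chernoff.
Variable R : realType.

(** Convexity: on [0, 1] the exponential lies below its chord. *)
Lemma expR_chord (x : R) : 0 <= x <= 1 -> expR x <= 1 + (expR 1 - 1) * x.
Proof.
move=> x01.
have := @convex_expR R (Itv01 (andP x01).1 (andP x01).2) 1 0.
rewrite !convRE /= expR0 mulr1 mulr0 addr0 => /le_trans; apply.
by rewrite /unstable.onem mulr1; lra.
Qed.

Lemma prod1D_le_expR (I : finType) (P : pred I) (q : R) : 0 <= q ->
  \prod_(i | P i) (1 + q) <= expR (#|I|%:R * q).
Proof.
move=> q0; rewrite prodr_const expRM_natl.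
apply: le_trans (_ : (1 + q) ^+ #|I| <= _).
  by rewrite ler_weXn2l ?max_card// lerDl.
by rewrite lerXn2r ?nnegrE ?addr_ge0 ?expR_ge0// expR_ge1Dx.
Qed.

(* The row-sum bound [hq] is only assumed where [p i != 0], so that a null class
   may carry an arbitrary kernel. *)
Section configurations.
Variables (I : finType) (p : I -> R) (h : I -> I -> R) (q : R).
Hypotheses (p0 : forall i, 0 <= p i) (p1 : \sum_i p i <= 1).
Hypotheses (h01 : forall i j, 0 <= h i j <= 1).
Hypotheses (q0 : 0 <= q) (hq : forall i, p i != 0 -> \sum_j p j * h i j <= q).

Let e1 : 0 <= expR 1 - 1 :> R.
Proof. by rewrite subr_ge0 ltW// expR_gt1. Qed.

Lemma mgf_le i : p i != 0 -> \sum_j p j * expR (h i j) <= 1 + (expR 1 - 1) * q.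
Proof.
move=> pi0; apply: (@le_trans _ _ (\sum_j (p j + (expR 1 - 1) * (p j * h i j)))).
  apply: ler_sum => j _; rewrite mulrCA -{2}[p j]mulr1 -mulrDr.
  by rewrite ler_wpM2l// expR_chord.
by rewrite big_split/= -mulr_sumr lerD// ler_wpM2l// hq.
Qed.

(** Once the indicator is absorbed into the factor of index [l], the sum over configurations is a
    product of sums over single coordinates. Coordinate [l] gives at most [p i * expR 1], each other
    one at most the bound of [mgf_le]. *)
Lemma conditional_mgf_le n (l : 'I_n) i :
  \sum_(c : {ffun 'I_n -> I}) (c l == i)%:R * \prod_m (p (c m) * expR (h i (c m)))
  <= p i * expR 1 * expR (n%:R * ((expR 1 - 1) * q)).
Proof.
have [pi0|pi0] := eqVneq (p i) 0.
  rewrite pi0 !mul0r big1// => c _; have [cl|] := eqVneq (c l) i; last by rewrite mul0r.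
  by rewrite (bigD1 l)//= cl pi0 !mul0r mulr0.
pose F m j := (if m == l then (j == i)%:R else 1) * (p j * expR (h i j)).
under eq_bigr => c _.
  rewrite (_ : _ * _ = \prod_m F m (c m)); last first.
    rewrite /F [RHS]big_split/=; congr (_ * _).
    by rewrite (bigD1 l)//= eqxx big1 ?mulr1// => m /negPf ->.
  over.
rewrite -bigA_distr_bigA (bigD1 l)//=.
have F0 m j : 0 <= F m j.
  by rewrite /F !mulr_ge0 ?expR_ge0//; case: ifP.
apply: ler_pM; [exact: sumr_ge0|by apply: prodr_ge0 => m _; exact: sumr_ge0| |].
  rewrite (bigD1 i)//= /F !eqxx mul1r big1 ?addr0; last first.
    by move=> j /negPf ->; rewrite mul0r.
  by rewrite ler_wpM2l// ler_expR; case/andP: (h01 i i).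
rewrite -[in n%:R](card_ord n).
apply: le_trans (prod1D_le_expR (fun m => m != l) (mulr_ge0 e1 q0)).
apply: ler_prod => m ml; rewrite sumr_ge0//=.
rewrite [X in X <= _](_ : _ = \sum_j p j * expR (h i j)) ?mgf_le//.
by apply: eq_bigr => j _; rewrite /F (negPf ml) mul1r.
Qed.

(** Union bound over [l], split by the class [i] of [l], then Markov: the indicator of t <= S is at
    most e^{S - t}. The 1 in [expR (1 - t)] pays for the diagonal term [h i i]. *)
Lemma chernoff_configurations n (t : R) :
  \sum_(c : {ffun 'I_n -> I} | [exists l, t <= \sum_m h (c l) (c m)]) \prod_m p (c m)
  <= n%:R * (expR (1 - t) * expR (n%:R * ((expR 1 - 1) * q))).
Proof.
pose G (c : {ffun 'I_n -> I}) l i :=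
  (c l == i)%:R * \prod_m (p (c m) * expR (h i (c m))).
have G0 c l i : 0 <= G c l i.
  by rewrite mulr_ge0// prodr_ge0// => m _; rewrite mulr_ge0 ?expR_ge0.
apply: (@le_trans _ _ (\sum_c \sum_l \sum_i expR (- t) * G c l i)); last first.
  rewrite exchange_big/=.
  rewrite -[in n%:R * (_ * _)](card_ord n) mulr_natl -sumr_const; apply: ler_sum => l _.
  rewrite exchange_big/=.
  under eq_bigr do rewrite -mulr_sumr.
  apply: (@le_trans _ _ (\sum_i expR (- t) * (p i * expR 1 * expR (n%:R * ((expR 1 - 1) * q))))).
    by apply: ler_sum => i _; rewrite ler_wpM2l ?expR_ge0// conditional_mgf_le.
  rewrite -mulr_sumr -2!mulr_suml expRD [expR 1 * _]mulrC -!mulrA ler_wpM2l ?expR_ge0//.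
  by rewrite card_ord ler_piMl// mulr_ge0 ?expR_ge0.
rewrite big_mkcond; apply: ler_sum => c _.
have S0 : 0 <= \sum_l \sum_i expR (- t) * G c l i.
  by apply: sumr_ge0 => l _; apply: sumr_ge0 => i _; rewrite mulr_ge0 ?expR_ge0.
case: ifP => // /existsP[l tl].
(* Only the term of this [l] with [i = c l] is kept; the others are nonnegative. *)
rewrite [leRHS](bigD1 l)//= (bigD1 (c l))//= {1}/G eqxx mul1r big_split/= -expR_sum.
apply: (@le_trans _ _ (expR (- t) * (\prod_m p (c m) * expR (\sum_m h (c l) (c m))))).
  rewrite mulrCA -expRD ler_peMr ?prodr_ge0// -expR0 ler_expR; lra.
rewrite -addrA lerDl addr_ge0 ?sumr_ge0// => *.
  by rewrite mulr_ge0 ?expR_ge0 ?G0.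
by rewrite sumr_ge0// => *; rewrite mulr_ge0 ?expR_ge0 ?G0.
Qed.

End configurations.
End Chernoff.

(** * Circular distance of cells and logarithmic row sums *)

Section CellDistance.
Variable R : realType.

(* The [maxn] caps the value at 1 for adjacent cells; it also absorbs [0^-1 = 0]. *)
Definition invdist (k : nat) : R := (maxn 1 k.-1)%:R^-1.
(** The two terms are the two ways round a circle of [n] cells. *)
Definition cell_kernel n (k : nat) : R := Num.min 1 (invdist k + invdist (n - k)).

Lemma invdist_ge0 k : 0 <= invdist k. Proof. by rewrite invr_ge0. Qed.

Lemma cell_kernel01 n k : 0 <= cell_kernel n k <= 1.
Proof. by rewrite ge_min lexx le_min ler01 addr_ge0 ?invdist_ge0. Qed.


(** The first three terms are 1; afterwards each new term 1 / (n + 1) is at most ln (n + 1) - ln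
    n. *)
Lemma sum_invdist_le n : (0 < n)%N ->
  \sum_(k < n.+2) invdist k <= 3 + ln n%:R.
Proof.
elim: n => // -[_ _|n IH _].
  by rewrite !big_ord_recl big_ord0 /invdist ln1 /= invr1; lra.
rewrite big_ord_recr/=; apply: le_trans (lerD (IH isT) (lexx _)) _.
rewrite -addrA lerD2l {1}/invdist/= (maxn_idPr _)//.
have n0 : 0 < n.+1%:R :> R by [].
have n1 : 0 < n.+2%:R :> R by [].
have : ln (1 + - n.+2%:R^-1) <= - n.+2%:R^-1 :> R.
  by apply: le_ln1Dx; rewrite ltrN2 invf_lt1// ltr1n.
rewrite (_ : 1 + - n.+2%:R^-1 = n.+1%:R / n.+2%:R); last first.
  by rewrite -[n.+1%:R](addrK 1) natr1 mulrBl divff ?mul1r// lt0r_neq0.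
by rewrite ln_div ?posrE// lerBlDl lerBrDr.
Qed.

Lemma sum_cell_kernel_le n (i : 'I_n) : (0 < n)%N ->
  \sum_(j < n) cell_kernel n `|i - j|%N <= 6 + 2 * ln n%:R.
Proof.
case: n i => // n i _.
pose g k := invdist k + invdist (n.+1 - k).
have ln0 : \sum_(k < n.+1) invdist k <= 3 + ln n.+1%:R.
  apply: le_trans (sum_invdist_le _) => //.
  by rewrite [leRHS]big_ord_recr [X in _ <= X + _]big_ord_recr/= -addrA lerDl addr_ge0 ?invdist_ge0.
have ln1 : \sum_(k < n.+1) invdist (n.+1 - k) <= 3 + ln n.+1%:R.
  apply: le_trans (sum_invdist_le _) => //.
  (* Reversal makes the arguments run over 1, ..., [n.+1], a part of the range of the larger sum. *)
  rewrite (reindex_inj rev_ord_inj)/= [leRHS]big_ord_recl [X in _ <= _ + X]big_ord_recr/=.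
  rewrite (eq_bigr (fun k : 'I_n.+1 => invdist (bump 0 k))); last first.
    by move=> k _; congr invdist; have := ltn_ord k; rewrite /bump/=; lia.
  by rewrite addrCA lerDl addr_ge0 ?invdist_ge0.
apply: (@le_trans _ _ (\sum_(k < n.+1) g k)); last first.
  by rewrite big_split/=; lra.
(* Translation by [i] modulo [n.+1]: the index difference becomes [k] or [n.+1 - k], and [g] is
   invariant under exchanging the two. *)
rewrite (reindex_inj (addrI i))/=; apply: ler_sum => k _.
suff -> : g k = g `|i - (i + k)%R|%N by rewrite ge_min lexx orbT.
rewrite /g/=.
have [ki|ki] := ltnP (i + k) n.+1.
  by rewrite modn_small// (_ : `|_|%N = k)//; lia.
have kn := ltn_ord k; have il := ltn_ord i.
have -> : ((i + k) %% n.+1 = i + k - n.+1)%N.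
  by rewrite -[in LHS](subnK ki) modnDr modn_small//; lia.
rewrite (_ : `|_|%N = (n.+1 - k)%N); last by lia.
by rewrite addrC; congr (_ + invdist _); lia.
Qed.

End CellDistance.

(** * Gershgorin's theorem and the spectrum of a Gram matrix *)

Section Spectrum.
Variable R : realType.

Lemma normc_ge0 (z : R[i]) : 0 <= normc z.
Proof. by case: z => a b; rewrite sqrtr_ge0. Qed.

Lemma normc_gt0 (z : R[i]) : z != 0 -> 0 < normc z.
Proof.
move=> z0; rewrite lt_neqAle normc_ge0 andbT eq_sym.
by apply: contra z0 => /eqP/ComplexField.Normc.eq0_normc ->.
Qed.

Lemma conjc_mul (z : R[i]) : conjc z * z = (normc z ^+ 2)%:C%C.
Proof. by rewrite mulrC -sqr_normc rmorphXn. Qed.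

(** Take [m] where the eigenvector has its largest modulus. Eigenvectors are row vectors here, hence
    column sums. *)
Lemma gershgorin n (A : 'M[R[i]]_n) a : eigenvalue A a ->
  exists m, normc a <= \sum_l normc (A l m).
Proof.
move=> /eigenvalueP[v vA v0].
have [m0 vm0] : exists m, v 0 m != 0 by apply/rV0Pn.
case: (@arg_maxP _ _ _ m0 xpredT (fun m => normc (v 0 m)) isT) => m _ mmax.
have vm : 0 < normc (v 0 m).
  exact: lt_le_trans (normc_gt0 vm0) (mmax m0 isT).
exists m; rewrite -(ler_pM2r vm) -ComplexField.Normc.normcM mulr_suml.
have -> : a * v 0 m = \sum_l v 0 l * A l m.
  by have /matrixP/(_ 0 m) := vA; rewrite !mxE => <-.
apply: le_trans (normc_sum _ _) _; apply: ler_sum => l _.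
rewrite ComplexField.Normc.normcM mulrC ler_wpM2l ?normc_ge0//; exact: mmax.
Qed.

(** V^*V is normal, so a unitary [P] diagonalizes it. The diagonal form is the Gram matrix of V P^*,
    so its entries are squared column norms. *)
Lemma gram_diagonalization n (V : 'M[R[i]]_n) : exists d : 'I_n -> R, exists P : 'M[R[i]]_n,
  [/\ forall i, 0 <= d i, P \in unitmx &
   P *m (adjmx V *m V) = diag_mx (\row_i (d i)%:C%C) *m P].
Proof.
set A := adjmx V *m V.
have adjE m p (B : 'M[R[i]]_(m, p)) : adjmx B = map_mx Num.conj B^T.
  by rewrite /adjmx map_trmx.
have adjM m p q (B : 'M[R[i]]_(m, p)) (C : 'M[R[i]]_(p, q)) : adjmx (B *m C) = adjmx C *m adjmx B.
  by rewrite !adjE trmx_mul map_mxM.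
have adjK m p (B : 'M[R[i]]_(m, p)) : adjmx (adjmx B) = B.
  by apply/matrixP => i j; rewrite !mxE conjcK.
have /normalmxP/orthomx_spectral_subproof [[P D] /= PU AE] : A *m map_mx Num.conj A^T = map_mx Num.conj A^T *m A.
  by rewrite -adjE /A adjM adjK.
have PA : P *m A = diag_mx D *m P.
  by rewrite AE !mulmxA mulmxV ?mul1mx// unitarymx_unit.
have AD : diag_mx D = adjmx (V *m adjmx P) *m (V *m adjmx P).
  rewrite adjM adjK -mulmxA (mulmxA (adjmx V)) -/A mulmxA PA -mulmxA adjE.
  by rewrite (unitarymxP PU) mulmx1.
have D0 i : D 0 i = (\sum_k normc ((V *m adjmx P) k i) ^+ 2)%:C%C.
  have /matrixP/(_ i i) := AD; rewrite [X in X = _]mxE eqxx mulr1n => ->.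
  rewrite mxE rmorph_sum; apply: eq_bigr => k _.
  by apply: etrans (conjc_mul _); congr (_ * _); rewrite mxE [LHS]mxE.
exists (fun i => \sum_k normc ((V *m adjmx P) k i) ^+ 2), P; split.
- by move=> i; rewrite sumr_ge0// => k _; rewrite sqr_ge0.
- exact: unitarymx_unit.
- by rewrite PA; congr (diag_mx _ *m _); apply/rowP => i; rewrite mxE D0.
Qed.

(** The size [n.+1] makes the spectrum nonempty; being finite, it attains the supremum defining
    [lambda_max]. *)
Lemma gram_lambda_max n (V : 'M[R[i]]_n.+1) (A := adjmx V *m V) :
  exists d : 'I_n.+1 -> R,
  [/\ forall i, 0 <= d i <= lambda_max A, exists i, d i = lambda_max A,
      eigenvalue A (lambda_max A)%:C%C &
      forall k, complex.Re (\tr (A ^+ k)) = \sum_i d i ^+ k].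
Proof.
have [d [P [d0 Pu PA]]] := gram_diagonalization V; rewrite -/A in PA.
set D := diag_mx _ in PA.
(* Row [i] of [P] is an eigenvector, nonzero because [P] is invertible. *)
have eigd i : eigenvalue A (d i)%:C%C.
  apply/eigenvalueP; exists (row i P).
    rewrite -row_mul PA /D; apply/rowP => j; rewrite !mxE (bigD1 i)//= big1 ?addr0; last first.
      by move=> k ki; rewrite !mxE eq_sym (negPf ki) mulr0n mul0r.
    by rewrite !mxE eqxx mulr1n.
  apply/eqP => /(congr1 (mulmx^~ (invmx P))).
  rewrite -row_mul mulmxV// mul0mx => /rowP/(_ i)/eqP.
  by rewrite !mxE eqxx oner_eq0.
have eigE a : eigenvalue A a -> exists i, a = (d i)%:C%C.
  move=> /eigenvalueP[v vA v0].
  pose w := v *m invmx P.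
  have w0 : w != 0.
    by apply: contra v0 => /eqP w0; rewrite -[v](mulmxKV Pu) -/w w0 mul0mx.
  have wD : w *m D = a *: w.
    have : w *m D *m P = a *: (w *m P).
      by rewrite -mulmxA -PA /w mulmxA mulmxKV.
    move=> /(congr1 (mulmx^~ (invmx P))).
    by rewrite -scalemxAl !mulmxK.
  have [i wi] : exists i, w 0 i != 0 by apply/rV0Pn.
  move: w wD wi {w0} => w wD wi.
  exists i; have /rowP/(_ i) := wD.
  rewrite !mxE (bigD1 i)//= big1 ?addr0; last first.
    by move=> k ki; rewrite !mxE (negPf ki) mulr0n mulr0.
  by rewrite !mxE eqxx mulr1n mulrC => H; exact: esym (mulIf wi H).
have [i0 _ i0max] := @arg_maxP _ _ _ (ord0 : 'I_n.+1) xpredT d isT.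
have lE : lambda_max A = d i0.
  apply/eqP; rewrite eq_le; apply/andP; split.
    apply: ge_sup; first by exists (d i0), (d i0)%:C%C.
    by move=> _ [a [/eigE[i ->] ->]]; exact: i0max.
  apply: ub_le_sup; last by exists (d i0)%:C%C.
  by exists (d i0) => _ [a [/eigE[i ->] ->]]; exact: i0max.
exists d; split.
- by move=> i; rewrite d0 lE; exact: i0max.
- by exists i0.
- by rewrite lE.
move=> k.
have PAk : P *m A ^+ k = diag_mx (\row_i (d i ^+ k)%:C%C) *m P.
  elim: k => [|k IH].
    rewrite expr0 mulmx1; rewrite (_ : diag_mx _ = 1%:M) ?mul1mx//.
    by apply/matrixP => i j; rewrite !mxE.
  rewrite exprS -[_ * _]/(A *m _) mulmxA PA -mulmxA IH mulmxA mulmx_diag.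
  congr (diag_mx _ *m _); apply/rowP => i.
  by rewrite !mxE exprS rmorphM.
have -> : A ^+ k = invmx P *m (diag_mx (\row_i (d i ^+ k)%:C%C) *m P).
  by rewrite -PAk mulKmx.
rewrite mxtrace_mulC mulmxK// mxtrace_diag.
under eq_bigr do rewrite mxE.
by rewrite -rmorph_sum.
Qed.

Lemma le_lambda_max_gram n (V : 'M[R[i]]_n.+1) (t : R) :
  t <= lambda_max (adjmx V *m V) ->
  exists m, t <= \sum_l normc ((adjmx V *m V) l m).
Proof.
move=> tl; have [d [d0 [i di] /gershgorin[m hm] _]] := gram_lambda_max V.
exists m; apply: le_trans hm; apply: le_trans tl _.
by rewrite normcR// -di; case/andP: (d0 i).
Qed.

(* The trace of the [k]-th power lies between the [k]-th power of the top
   eigenvalue and [n] times it. *)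
Lemma le_lambda_max_gramP n (V : 'M[R[i]]_n.+1) (t : R) : 0 < t ->
  t <= lambda_max (adjmx V *m V) <->
  forall k, t ^+ k <= complex.Re (\tr ((adjmx V *m V) ^+ k)).
Proof.
move=> t0; have [d [d0 [i0 di] _ trE]] := gram_lambda_max V.
set l := lambda_max _ in d0 di *; split=> [tl k|h].
  rewrite trE (bigD1 i0)//= di; apply: le_trans (_ : l ^+ k <= _).
    by rewrite lerXn2r// nnegrE ltW// (lt_le_trans t0).
  by rewrite lerDl sumr_ge0// => i _; rewrite exprn_ge0//; case/andP: (d0 i).
rewrite leNgt; apply/negP => lt.
have l0 : 0 <= l by rewrite -di; case/andP: (d0 i0).
(* If l < t these powers tend to 0, which this uniform lower bound forbids. *)
have hk k : n.+1%:R^-1 <= (l / t) ^+ k.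
  rewrite expr_div_n ler_pdivlMr ?exprn_gt0// mulrC ler_pdivrMr//.
  apply: le_trans (h k) _; rewrite trE mulr_natr -[in leRHS](card_ord n.+1) -sumr_const.
  by apply: ler_sum => i _; case/andP: (d0 i) => di0 dil; rewrite lerXn2r ?nnegrE.
have q0 : 0 <= l / t by rewrite divr_ge0// ltW.
have : (fun k => (l / t) ^+ k) @ \oo --> (0 : R).
  by apply: cvg_expr; rewrite ger0_norm// ltr_pdivrMr// mul1r.
move=> /cvgrPdist_lt/(_ n.+1%:R^-1)[|N _ /(_ N (leqnn _))]; first by rewrite invr_gt0.
by rewrite /= sub0r normrN ger0_norm ?exprn_ge0// ltNge hk.
Qed.

End Spectrum.

(** * Measurability of the event on the largest eigenvalue *)

Section Measurability.
Context {R : realType} {d : measure_display} {T : measurableType d}.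

(** Expressed through real and imaginary parts, so that only real measurable functions occur. *)
Definition cmeasurable (g : T -> R[i]) :=
  measurable_fun setT (fun w => complex.Re (g w)) /\
  measurable_fun setT (fun w => complex.Im (g w)).

Lemma eq_cmeasurable f g : f =1 g -> cmeasurable g -> cmeasurable f.
Proof. by move=> /funext ->. Qed.

Lemma cmeasurable_cst (z : R[i]) : cmeasurable (fun=> z).
Proof. by split; exact: measurable_cst. Qed.

Lemma cmeasurableD f g : cmeasurable f -> cmeasurable g ->
  cmeasurable (fun w => f w + g w).
Proof.
move=> [rf jf] [rg jg]; split.
  rewrite (_ : (fun _ => _) = (fun w => complex.Re (f w) + complex.Re (g w))).
    exact: measurable_funD.
  by apply/funext => w; case: (f w) (g w) => [a b] [u v].
rewrite (_ : (fun _ => _) = (fun w => complex.Im (f w) + complex.Im (g w))).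
  exact: measurable_funD.
by apply/funext => w; case: (f w) (g w) => [a b] [u v].
Qed.

Lemma cmeasurableM f g : cmeasurable f -> cmeasurable g ->
  cmeasurable (fun w => f w * g w).
Proof.
move=> [rf jf] [rg jg]; split.
  rewrite (_ : (fun _ => _) = (fun w => complex.Re (f w) * complex.Re (g w)
                                  - complex.Im (f w) * complex.Im (g w))).
    by apply: measurable_funB; exact: measurable_funM.
  by apply/funext => w; case: (f w) (g w) => [a b] [u v].
rewrite (_ : (fun _ => _) = (fun w => complex.Re (f w) * complex.Im (g w)
                                  + complex.Im (f w) * complex.Re (g w))).
  by apply: measurable_funD; exact: measurable_funM.
by apply/funext => w; case: (f w) (g w) => [a b] [u v].
Qed.

Lemma cmeasurable_conjc f : cmeasurable f -> cmeasurable (fun w => conjc (f w)).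
Proof.
move=> [rf jf]; split.
  by rewrite (_ : (fun _ => _) = (fun w => complex.Re (f w)))//;
    apply/funext => w; case: (f w).
rewrite (_ : (fun _ => _) = (fun w => - complex.Im (f w))).
  exact: measurable_funN.
by apply/funext => w; case: (f w).
Qed.

Lemma cmeasurable_sum (I : Type) (r : seq I) (F : I -> T -> R[i]) :
  (forall i, cmeasurable (F i)) -> cmeasurable (fun w => \sum_(i <- r) F i w).
Proof.
move=> mF; elim: r => [|i0 r IH].
  by apply: eq_cmeasurable (cmeasurable_cst 0) => w; rewrite big_nil.
by apply: eq_cmeasurable (cmeasurableD (mF i0) IH) => w; rewrite big_cons.
Qed.

Lemma cmeasurable_mulmx m n p (A : T -> 'M[R[i]]_(m, n)) (B : T -> 'M[R[i]]_(n, p)) :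
  (forall i j, cmeasurable (fun w => A w i j)) ->
  (forall i j, cmeasurable (fun w => B w i j)) ->
  forall i j, cmeasurable (fun w => (A w *m B w) i j).
Proof.
move=> mA mB i j.
apply: (eq_cmeasurable (g := fun w => \sum_k A w i k * B w k j)) => [w|].
  by rewrite mxE.
by apply: cmeasurable_sum => k; exact: cmeasurableM.
Qed.

Lemma cmeasurable_vandermonde n (theta : 'I_n -> T -> R) :
  (forall l, measurable_fun setT (theta l)) ->
  forall i j, cmeasurable (fun w => vandermonde (theta^~ w) i j).
Proof.
move=> mth i j.
apply: (eq_cmeasurable (fun w => mxE _ _ _ _)).
apply: cmeasurableM; first exact: cmeasurable_cst.
have mphase : measurable_fun setT (fun w => - (i%:R * theta j w)).
  by apply: measurable_funN; apply: measurable_funM => //; exact: measurable_cst.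
split => /=.
  apply: measurableT_comp mphase; apply: continuous_measurable_fun; exact: continuous_cos.
apply: measurableT_comp mphase; apply: continuous_measurable_fun; exact: continuous_sin.
Qed.

(** The trace criterion writes the event as a countable intersection of conditions on traces of
    powers, which are built from the entries by sums, products and conjugation. *)
Lemma measurable_lambda_max_gram n (V : T -> 'M[R[i]]_n.+1) (t : R) : 0 < t ->
  (forall i j, cmeasurable (fun w => V w i j)) ->
  measurable [set w | t <= lambda_max (adjmx (V w) *m V w)].
Proof.
move=> t0 mV.
have mA : forall i j, cmeasurable (fun w => (adjmx (V w) *m V w) i j).
  apply: cmeasurable_mulmx => // i j.
  apply: (eq_cmeasurable (g := fun w => conjc (V w j i))) => [w|].
    by rewrite !mxE.
  exact: cmeasurable_conjc.
have mAk k : forall i j, cmeasurable (fun w => ((adjmx (V w) *m V w) ^+ k) i j).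
  elim: k => [|k IH] i j; first exact: cmeasurable_cst.
  apply: (eq_cmeasurable (g := fun w => ((adjmx (V w) *m V w) *m
    (adjmx (V w) *m V w) ^+ k) i j)) => [w|]; first by rewrite exprS.
  exact: cmeasurable_mulmx.
rewrite [X in measurable X](_ : _ = \bigcap_(k in [set: nat])
  [set w | t ^+ k <= complex.Re (\tr ((adjmx (V w) *m V w) ^+ k))]); last first.
  apply/seteqP; split => [w /(le_lambda_max_gramP _ t0) h k _|w h]; first exact: h.
  by apply/(le_lambda_max_gramP _ t0) => k; exact: h.
apply: bigcap_measurable; first by exists 0%N.
move=> k _; have [mt _] : cmeasurable (fun w => \tr ((adjmx (V w) *m V w) ^+ k)).
  exact: cmeasurable_sum.
have := mt measurableT `[t ^+ k, +oo[%classic (measurable_itv _).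
rewrite setTI; congr measurable; apply/seteqP; split => w /=;
  by rewrite in_itv/= andbT.
Qed.

End Measurability.

(** * Cells of the circle and the bound of Gram entries by the kernel *)

Section Cells.
Variable R : realType.
Implicit Types (x y s : R) (n : nat).

(** Used with [D] the modulus of a Dirichlet sum and [S] the sine of the half angle. *)
Lemma div_le_inv n m (D S : R) : (0 < m)%N -> (0 < n)%N -> 0 <= D -> D * S <= 1 ->
  m%:R / n%:R <= S -> n%:R^-1 * D <= m%:R^-1.
Proof.
move=> m0 n0 D0 DS mS; rewrite -[leRHS]mul1r ler_pdivlMr ?ltr0n//.
by apply: le_trans DS; rewrite -mulrA mulrCA ler_wpM2l// mulrC.
Qed.

Lemma invdistE k : (1 < k)%N -> invdist R k = k.-1%:R^-1.
Proof. by move=> k1; rewrite /invdist (maxn_idPr _)//; lia. Qed.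

Lemma invdist_small k : (k <= 1)%N -> invdist R k = 1.
Proof. by move=> k1; rewrite /invdist (maxn_idPl _) ?invr1//; lia. Qed.

(* Concavity of [sin] on [0, pi] is replaced by the cruder
   [sin s >= min (s / 2) ((pi - s) / 2)], with [pi / 2 >= 1] absorbing the loss. *)
Lemma dirichlet_le_kernel n (k : nat) (D s : R) : (k < n)%N ->
  0 <= D -> D <= n%:R -> D * sin s <= 1 ->
  pi * (k%:R - 1) / n%:R <= s <= pi * (k%:R + 1) / n%:R ->
  n%:R^-1 * D <= cell_kernel R n k.
Proof.
move=> kn D0 Dn Ds sk; have n0 : (0 < n)%N by exact: leq_ltn_trans kn.
have n0' : 0 < n%:R :> R by rewrite ltr0n.
have p2 := pi_ge2 R.
rewrite le_min mulrC ler_pdivrMr// mul1r Dn/= mulrC.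
(* Equal or adjacent cells, and next those adjacent across the cut of the circle: one [invdist] is 1
   and D <= n suffices. *)
have [k1|k1] := leqP k 1.
  rewrite (invdist_small k1) mulrC ler_pdivrMr//; apply: le_trans Dn _.
  by rewrite mulrDl mul1r lerDl mulr_ge0// invdist_ge0.
have [k2|k2] := leqP (n - k) 1.
  rewrite (invdist_small k2) mulrC ler_pdivrMr//; apply: le_trans Dn _.
  by rewrite mulrDl mul1r lerDr mulr_ge0// invdist_ge0.
have kR : k.-1%:R = k%:R - 1 :> R by rewrite -subn1 natrB// ltnW.
have nkR : (n - k).-1%:R = n%:R - k%:R - 1 :> R.
  by rewrite -subn1 natrB ?natrB// ltnW.
have kge : 0 <= k.-1%:R :> R by [].
have nkge : 0 <= (n - k).-1%:R :> R by [].
have a0 : 0 <= k.-1%:R / n%:R :> R by rewrite divr_ge0.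
have b0 : 0 <= (n - k).-1%:R / n%:R :> R by rewrite divr_ge0.
have abE : (n - k).-1%:R / n%:R = 1 - (k%:R + 1) / n%:R :> R.
  by rewrite nkR; field; rewrite lt0r_neq0.
move: sk; rewrite -!mulrA -kR => /andP[sk1 sk2].
have s1 : 0 <= s by apply: le_trans sk1; rewrite mulr_ge0// pi_ge0.
have s2 : s <= pi - pi * ((n - k).-1%:R / n%:R) by rewrite abE; lra.
have s3 : s <= pi by apply: le_trans s2 _; rewrite gerBl mulr_ge0// pi_ge0.
(* On the left half the sine is controlled by [s], hence by [k]; on the right half by [pi - s],
   hence by [n - k]. *)
have [sp|sp] := leP s (pi / 2).
  have hs : s / 2 <= sin s by apply: sin_ge_half; rewrite s1.
  apply: le_trans (_ : invdist R k <= _); last by rewrite lerDl invdist_ge0.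
  have k0 : (0 < k.-1)%N by rewrite -subn1 subn_gt0.
  rewrite invdistE//; apply: (div_le_inv k0 n0 D0 Ds).
  by apply: le_trans hs; have := ler_wpM2r a0 p2; lra.
have hs : (pi - s) / 2 <= sin s by apply: sin_ge_half_sub; rewrite s3 ltW.
apply: le_trans (_ : invdist R (n - k) <= _); last by rewrite lerDr invdist_ge0.
have nk0 : (0 < (n - k).-1)%N by rewrite -subn1 subn_gt0.
rewrite invdistE//; apply: (div_le_inv nk0 n0 D0 Ds).
by apply: le_trans hs; have := ler_wpM2r b0 p2; lra.
Qed.

Definition cell_left n (j : nat) : R := - pi + 2 * pi * j%:R / n%:R.

(* [None] is the class of the phases outside [-pi, pi[, which has probability 0. *)
Definition cell n (o : option 'I_n) : set R :=
  if o is Some j then `[cell_left n j, cell_left n j.+1[%classic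
  else ~` `[- pi, pi[%classic.

Lemma measurable_cell n o : measurable (@cell n o).
Proof. by case: o => [j|] /=; [|apply: measurableC]; exact: measurable_itv. Qed.

(** The default 1 is the trivial bound on a Gram entry, valid for any phases. *)
Definition configuration_kernel n (o o' : option 'I_n) : R :=
  match o, o' with Some i, Some j => cell_kernel R n `|i - j|%N | _, _ => 1 end.

(** For cells at index distance k, half the phase difference is, up to sign, within pi / n of pi k /
    n. *)
Lemma gram_le_configuration_kernel n (theta : 'I_n -> R) (c : 'I_n -> option 'I_n) l m :
  (forall i, cell (c i) (theta i)) ->
  normc ((adjmx (vandermonde theta) *m vandermonde theta) l m)
    <= configuration_kernel (c m) (c l).
Proof.
move=> hc; rewrite gram_vandermondeE ComplexField.Normc.normcM normcR ?invr_ge0//.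
have n0 : (0 < n)%N by case: (n) l => // -[].
have n0' : 0 < n%:R :> R by rewrite ltr0n.
set t := theta l - theta m.
have Dn := dirichlet_le_nat n t.
have Ds := dirichlet_le_sin n t.
have := hc l; have := hc m; rewrite /configuration_kernel.
have le1 : n%:R^-1 * normc (\sum_(k < n) expj (k%:R * t)) <= 1.
  by rewrite mulrC ler_pdivrMr// mul1r.
case: (c m) => [i|] //; case: (c l) => [j|] //=.
rewrite !in_itv/= /cell_left => /andP[i1 i2] /andP[j1 j2].
have kn : (`|i - j| < n)%N by have := ltn_ord i; have := ltn_ord j; lia.
have absle (s : R) : normc (\sum_(k < n) expj (k%:R * t)) * `|sin s| <= 1 ->
    normc (\sum_(k < n) expj (k%:R * t)) * sin s <= 1.
  by apply: le_trans; rewrite ler_wpM2l ?normc_ge0// ler_norm.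
have p0 := pi_gt0 R.
have e k : 2 * pi * k.+1%:R / n%:R = 2 * pi * k%:R / n%:R + 2 * (pi / n%:R) :> R.
  by rewrite -natr1; field; rewrite lt0r_neq0.
move: i2 j2; rewrite !e => i2 j2.
have [ij|ij] := leqP i j.
  apply: dirichlet_le_kernel (absle _ Ds) _ => //; first exact: normc_ge0.
  have -> : `|i - j|%N%:R = j%:R - i%:R :> R by rewrite -natrB//; congr _%:R; lia.
  by rewrite /t; apply/andP; split; nra.
(* With the cells in the other order the half angle is negated; the absolute value of the sine is
   unchanged. *)
apply: (@dirichlet_le_kernel _ _ _ (- (t / 2))) => //; first exact: normc_ge0.
  by apply: absle; rewrite sinN normrN.
have -> : `|i - j|%N%:R = i%:R - j%:R :> R by rewrite -natrB 1?ltnW//; congr _%:R; lia.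
by rewrite /t; apply/andP; split; nra.
Qed.

Lemma cell_cover n x : (0 < n)%N -> exists o : option 'I_n, cell o x.
Proof.
move=> n0; have n0' : 0 < n%:R :> R by rewrite ltr0n.
have p0 := pi_gt0 R; have p20 : 0 < 2 * pi :> R by rewrite mulr_gt0.
have [xI|xI] := boolP (x \in `[- pi, pi[); last by exists None; apply/negP.
(* The phase measured in cell widths; its integer part is the cell index. *)
pose y := (x + pi) / (2 * pi) * n%:R.
move: xI; rewrite in_itv/= => /andP[x1 x2].
have y0 : 0 <= y by rewrite mulr_ge0// divr_ge0 ?(ltW p20)//; lra.
have yn : y < n%:R.
  rewrite gtr_pMl// ltr_pdivrMr//; lra.
have xE : x = - pi + 2 * pi * y / n%:R.
  by rewrite /y mulrA mulfK ?lt0r_neq0// mulrC divfK ?lt0r_neq0// addrC addrK.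
have /andP[t1 t2] := truncn_itv y0.
have tn : (Num.truncn y < n)%N by rewrite -(ltr_nat R); exact: le_lt_trans yn.
exists (Some (Ordinal tn)); rewrite /= in_itv/= /cell_left xE.
by rewrite lerD2l ltrD2l ler_pM2r ?invr_gt0// ltr_pM2r ?invr_gt0// ler_pM2l// ltr_pM2l// t1 t2.
Qed.

Lemma cell_subset n (j : 'I_n) : cell (Some j) `<=` `[- pi, pi]%classic.
Proof.
have n0 : (0 < n)%N by case: (n) j => // -[].
have n0' : 0 < n%:R :> R by rewrite ltr0n.
have p0 := pi_gt0 R; have p20 : 0 < 2 * pi :> R by rewrite mulr_gt0.
move=> x /=; rewrite !in_itv/= /cell_left => /andP[x1 x2]; apply/andP; split.
  by apply: le_trans x1; rewrite lerDl divr_ge0// mulr_ge0// ltW.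
apply/ltW/(lt_le_trans x2); rewrite addrC lerBlDr.
rewrite (_ : pi + pi = 2 * pi); last by ring.
by rewrite ler_pdivrMr// ler_pM2l// ler_nat ltn_ord.
Qed.

Lemma trivIset_cell n : trivIset setT (fun j : 'I_n => cell (Some j)).
Proof.
have lt_disj (i j : 'I_n) x : cell (Some i) x -> cell (Some j) x -> (i <= j)%N.
  have n0 : (0 < n)%N by case: (n) j => // -[].
  have n0' : 0 < n%:R :> R by rewrite ltr0n.
  rewrite /= !in_itv/= => /andP[x1 _] /andP[_ x2].
  have := le_lt_trans x1 x2.
  by rewrite ltrD2l ltr_pM2r ?invr_gt0// ltr_pM2l ?mulr_gt0 ?pi_gt0// ltr_nat.
move=> i j _ _ [x [xi xj]]; apply/val_inj/eqP.
by rewrite eqn_leq (lt_disj _ _ x)// (lt_disj _ _ x).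
Qed.

End Cells.

(** * Probabilities of cells under the density *)

Section LawOfCells.
Variables (R : realType) (f : R -> R) (M : R).
Hypotheses (mf : measurable_fun `[- pi, pi] f)
  (f0 : forall x, x \in `[- pi, pi] -> 0 <= f x)
  (f1 : (\int[lebesgue_measure]_(x in `[(-pi)%R, pi%R]%classic) (f x)%:E = 1)%E)
  (fM : Linf_norm_pi f = M%:E).

Let I : set R := `[- pi, pi]%classic.
Let mI : measurable I. Proof. exact: measurable_itv. Qed.

Let mEf (D : set R) : D `<=` I -> measurable_fun D (EFin \o f).
Proof. by move=> DI; apply/measurable_EFinP; exact: measurable_funS mf. Qed.

Lemma law_of_density_ge0 A : (0 <= law_of_density f A)%E.
Proof.
by apply: integral_ge0 => x [_ xI]; rewrite lee_fin f0.
Qed.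

Lemma law_of_density_le1 A : measurable A -> (law_of_density f A <= 1)%E.
Proof.
move=> mA; rewrite -f1; apply: ge0_subset_integral => //.
- exact: measurableI.
- exact: mEf.
Qed.

Lemma law_of_density_fin A : measurable A -> law_of_density f A \is a fin_num.
Proof.
move=> mA; rewrite ge0_fin_numE ?law_of_density_ge0//.
by apply: le_lt_trans (law_of_density_le1 mA) _; rewrite ltry.
Qed.

(** The function is nonnegative and the line has positive measure. *)
Lemma Linf_norm_pi_ge0 : 0 <= M.
Proof.
rewrite -lee_fin -fM; apply: ess_sup_gee.
  have := lebesgue_measure_itv (`]-oo, +oo[ : interval R).
  by rewrite set_itvNyy /= => ->; rewrite addye// ltry.
by apply: nearW => x; rewrite lee_fin mulr_ge0.
Qed.

Lemma law_of_density_itv (a b : R) : a <= b -> `[a, b[ `<=` `[- pi, pi]%classic ->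
  (law_of_density f `[a, b[%classic <= (M * (b - a))%:E)%E.
Proof.
move=> ab abI; rewrite /law_of_density setIidl//.
apply: (@le_trans _ _ (\int[lebesgue_measure]_(x in `[a, b[%classic) cst M%:E x)%E); last first.
  rewrite integral_cst// EFinM.
  rewrite [X in (_ * X)%E](_ : _ = (b - a)%:E)//.
  apply: etrans (lebesgue_measure_itv `[a, b[) _.
  rewrite /= lte_fin; case: ifPn => // /negPf ba.
  by rewrite (_ : a = b) ?subrr//; apply/eqP; rewrite eq_le ab leNgt ba.
apply: ae_ge0_le_integral => //.
- by move=> x /abI xI; rewrite lee_fin f0.
- exact: mEf.
- by move=> x _; rewrite lee_fin Linf_norm_pi_ge0.
have := ess_sup_ge lebesgue_measure (fun x : R => (`|f x| * \1_(`[-pi, pi]) x)%:E).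
rewrite -[ess_sup _ _]/(Linf_norm_pi f) fM.
apply: filterS => x h /abI xI; apply: le_trans h.
by rewrite lee_fin indicE mem_set// mulr1 ler_norm.
Qed.

(** Within [-pi, pi] this class is the single point pi, a null set. *)
Lemma law_of_cell_None n : law_of_density f (@cell R n None) = 0%E.
Proof.
rewrite /law_of_density; apply: (@integral_Sset1 _ _ _ pi) => x [].
by rewrite /= !in_itv/= => /negP; rewrite negb_and -leNgt -ltNge; lra.
Qed.

Lemma law_of_cell_le n (j : 'I_n) :
  (law_of_density f (@cell R n (Some j)) <= (M * (2 * pi / n%:R))%:E)%E.
Proof.
have n0 : (0 < n)%N by case: (n) j => // -[].
have n0' : 0 < n%:R :> R by rewrite ltr0n.
have e : @cell_left R n j.+1 - @cell_left R n j = 2 * pi / n%:R.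
  by rewrite /cell_left -natr1; field; rewrite lt0r_neq0.
rewrite -e; apply: law_of_density_itv; last exact: cell_subset.
by rewrite -subr_ge0 e divr_ge0// mulr_ge0// pi_ge0.
Qed.

Definition cell_prob n o : R := fine (law_of_density f (@cell R n o)).

Lemma cell_probE n o : (cell_prob o)%:E = law_of_density f (@cell R n o).
Proof. by rewrite fineK// law_of_density_fin//; exact: measurable_cell. Qed.

Lemma cell_prob_ge0 n o : 0 <= @cell_prob n o.
Proof. by rewrite -lee_fin cell_probE law_of_density_ge0. Qed.

Lemma cell_prob_None n : @cell_prob n None = 0.
Proof. by apply/EFin_inj; rewrite cell_probE law_of_cell_None. Qed.

Lemma sum_option (n : nat) (F : option 'I_n -> R) :
  \sum_o F o = F None + \sum_j F (Some j).
Proof.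
rewrite (bigD1 None)//=; congr (_ + _).
rewrite (reindex_omap Some id)/=; last by case.
by apply: eq_bigl => j; rewrite eqxx.
Qed.

Lemma sum_cell_prob_le1 n : \sum_o @cell_prob n o <= 1.
Proof.
rewrite sum_option cell_prob_None add0r -lee_fin -sumEFin.
under eq_bigr do rewrite cell_probE.
rewrite (eq_bigr (fun j : 'I_n =>
  (\int[lebesgue_measure]_(x in @cell R n (Some j)) (f x)%:E)%E)); last first.
  by move=> j _; rewrite /law_of_density setIidl//; exact: cell_subset.
have mC (j : 'I_n) : measurable (@cell R n (Some j)) by exact: measurable_cell.
have sub : \big[setU/set0]_(j < n) @cell R n (Some j) `<=` I.
  by elim/big_ind : _ => //= [A B AI BI x [/AI|/BI]//|j _]; exact: cell_subset.
rewrite -ge0_integral_bigsetU//=.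
- rewrite -f1; apply: ge0_subset_integral => //.
    exact: bigsetU_measurable.
  exact: mEf.
- exact: index_enum_uniq.
- by move=> i j _ _; exact: trivIset_cell.
- exact: mEf.
- by move=> x /sub xI; rewrite lee_fin f0.
Qed.

(** Mass at most 2 pi M / n per cell, times the kernel row sum. The nonzero mass of [i] rules out
    [None], whose kernel row is constantly 1. *)
Lemma sum_cell_prob_kernel_le n i : (0 < n)%N -> @cell_prob n i != 0 ->
  \sum_j cell_prob j * configuration_kernel R i j
    <= M * (2 * pi / n%:R) * (6 + 2 * ln n%:R).
Proof.
move=> n0; case: i => [i _|]; last by rewrite cell_prob_None eqxx.
rewrite sum_option cell_prob_None mul0r add0r.
apply: le_trans (_ : M * (2 * pi / n%:R) * \sum_(j < n) cell_kernel R n `|i - j|%N <= _).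
  rewrite mulr_sumr; apply: ler_sum => j _ /=.
  rewrite ler_wpM2r//; first by case/andP: (cell_kernel01 R n `|i - j|%N).
  by rewrite -lee_fin cell_probE law_of_cell_le.
rewrite ler_wpM2l ?sum_cell_kernel_le//.
by rewrite mulr_ge0 ?Linf_norm_pi_ge0// divr_ge0// mulr_ge0// pi_ge0.
Qed.

End LawOfCells.

(** * Union bound over configurations and the final tail estimate *)

Lemma le_measure_sum_cover (d : measure_display) (T : measurableType d) (R : realType)
    (mu : {measure set T -> \bar R}) (J : eqType) (s : seq J) (F : J -> set T) (E : set T) :
  measurable E -> (forall i, measurable (F i)) ->
  (forall w, E w -> exists2 i, i \in s & F i w) ->
  (mu E <= \sum_(i <- s) mu (F i))%E.
Proof.
move=> mE mF; case: s => [|x0 s] cov.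
  rewrite big_nil (_ : E = set0) ?measure0//.
  by apply/seteqP; split => // w /cov[].
rewrite (big_nth x0) big_mkord.
apply: (content_subadditive mu (F := fun k => F (nth x0 (x0 :: s) k))) => // w /cov[i si Fi].
rewrite -(bigcup_mkord _ (fun k => F (nth x0 (x0 :: s) k))).
by exists (index i (x0 :: s)); [rewrite -index_mem in si|rewrite /= nth_index].
Qed.

Theorem theorem5 (R : realType) (f : R -> R) (M : R) :
  measurable_fun `[-pi, pi] f ->
  (forall x, x \in `[-pi, pi] -> 0 <= f x) ->
  (\int[lebesgue_measure]_(x in `[(-pi)%R, pi%R]%classic) (f x)%:E = 1)%E ->
  Linf_norm_pi f = M%:E ->
  let C := 4 * pi * M * (expR 1 - 1) + 1 in
  exists K : R, 0 < K /\
  forall eps kappa : R, 0 < eps -> 0 < kappa < 1 ->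
  exists N0 : nat, forall N : nat, (N0 < N)%N -> forall u : R, 0 <= u ->
  forall (d : measure_display) (Omega : measurableType d)
         (P : probability Omega R) (theta : 'I_N -> Omega -> R),
    iid_with_law P theta (law_of_density f) ->
    (P [set w | ((C + eps) * ln (N%:R : R) + u <=
                lambda_max (adjmx (vandermonde (fun l => theta l w)) *m
                            vandermonde (fun l => theta l w)))%R]
     <= (K * expR (- u) / (N%:R `^ (eps * kappa)))%:E)%E.
Proof.
move=> mf f0 f1 fM C.
have M0 := Linf_norm_pi_ge0 fM.
have e1 : 0 <= expR 1 - 1 :> R by rewrite subr_ge0 ltW// expR_gt1.
have pi0 := pi_ge0 R.
(* The 1 comes from [expR (1 - t)], the rest from the constant 6 of the row sums, multiplied by 2 pi
   M (e - 1). *)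
exists (expR (1 + 12 * pi * M * (expR 1 - 1))); split; first exact: expR_gt0.
(* N >= 2 makes ln N, and then the threshold [t], positive. *)
move=> eps kappa eps0 /andP[kappa0 kappa1]; exists 1%N => -[//|n] n1 u u0.
move=> d Omega P theta [mtheta iid].
set t := _ + u; set E := [set w | _].
have ln0 : 0 < ln n.+1%:R :> R by rewrite ln_gt0// ltr1n.
have t0 : 0 < t.
  rewrite ltr_pwDl// mulr_gt0// addr_gt0// /C ltr_wpDl// !mulr_ge0//.
have mE : measurable E.
  apply: measurable_lambda_max_gram t0 _.
  exact: cmeasurable_vandermonde.
pose I := option 'I_n.+1.
pose bad := [pred c : {ffun 'I_n.+1 -> I} |
  [exists l, t <= \sum_m configuration_kernel R (c l) (c m)]].
pose F (c : {ffun 'I_n.+1 -> I}) := [set w | forall i, cell (c i) (theta i w)].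
have mF c : measurable (F c).
  rewrite /F (_ : [set w | _] = \bigcap_(i in [set: 'I_n.+1]) (theta i @^-1` cell (c i))).
    apply: fin_bigcap_measurable => // i _; rewrite -[X in measurable X]setTI.
    by apply: mtheta => //; exact: measurable_cell.
  by apply/seteqP; split => [w h i _|w h i]; apply: h.
have PF c : P (F c) = (\prod_i cell_prob f (c i))%:E.
  rewrite -prodEFin (iid (fun i => cell (c i))) => [|i]; last exact: measurable_cell.
  by apply: eq_bigr => i _; rewrite cell_probE.
have cover w : E w -> exists c, bad c /\ F c w.
  move=> /le_lambda_max_gram[m tm].
  have /fin_all_exists[c hc] i := cell_cover (theta i w) (isT : (0 < n.+1)%N).
  exists (finfun c); split; last by move=> i; rewrite ffunE.
  apply/existsP; exists m; apply: le_trans tm _; apply: ler_sum => l _.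
  by rewrite !ffunE; exact: gram_le_configuration_kernel.
have PE : (P E <= (\sum_(c | bad c) \prod_i cell_prob f (c i))%:E)%E.
  rewrite -sumEFin -big_filter; under eq_bigr do rewrite -PF.
  apply: le_measure_sum_cover => // w /cover[c [bc Fc]].
  by exists c; rewrite // mem_filter bc mem_index_enum.
apply: le_trans PE _; rewrite lee_fin.
(* N (e - 1) q is a constant plus 4 pi M (e - 1) ln N, the main part of [C]. *)
pose q := M * (2 * pi / n.+1%:R) * (6 + 2 * ln n.+1%:R).
have q0 : 0 <= q.
  by rewrite !mulr_ge0// ?invr_ge0// addr_ge0// mulr_ge0// ltW.
have kernel01 i j : 0 <= configuration_kernel R (n := n.+1) i j <= 1.
  by case: i j => [i|] [j|]; rewrite /= ?lexx ?ler01//; exact: cell_kernel01.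
apply: le_trans (chernoff_configurations (cell_prob_ge0 mf f0 f1 (n := n.+1))
  (sum_cell_prob_le1 mf f0 f1 n.+1) kernel01 q0
  (fun i => sum_cell_prob_kernel_le mf f0 f1 fM (i := i) isT) n.+1 t) _.
have n0 : (n.+1%:R : R) == 0 = false by rewrite gt_eqF.
(* The union-bound factor N becomes e^{ln N}, which the summand 1 of [C] compensates; only exponents
   remain to be compared. *)
rewrite /powR n0 -[X in X * _ <= _](@lnK R) ?posrE// -!expRD -expRN -!expRD.
rewrite ler_expR.
have -> : n.+1%:R * ((expR 1 - 1) * q) =
    (expR 1 - 1) * M * (2 * pi) * (6 + 2 * ln n.+1%:R).
  by rewrite /q; move: (n.+1%:R : R) n0 => x /negbT x0; field.
rewrite /t /C -subr_ge0.
rewrite (_ : _ - _ = eps * (1 - kappa) * ln n.+1%:R); last by ring.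
by rewrite !mulr_ge0 ?subr_ge0 ?ltW.
Qed.
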